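(* In base $4$, for all digit-counts $n$, the only fixed points and cycles of the Kaprekar transformation $T_{4,n}$ (excluding repdigits) are the following. Fixed points: (1) (symmetric) for $k_0,k_1\in\mathbb N$, with $n=2(k_0+k_1)$, the integer with base-$4$ digit string $3^{k_0}\,1^{k_1-1}\,0\,2^{k_1}\,0^{k_0-1}\,1$, with Kaprekar index $(k_0,k_1,k_1,k_0)$; (2) (almost-symmetric) for integers $k_0,k_1,k_3$ with $1\le k_0<k_3<k_0+k_1$ and $\alpha=k_3-k_0$, with $n=k_0+2k_1+k_3$, the integer with digit string $3^{k_0}\,2^{\alpha}\,1^{k_1-\alpha-1}\,0\,3^{\alpha}\,2^{k_1-\alpha}\,1^{\alpha}\,0^{k_0-1}\,1$, with Kaprekar index $(k_0,k_1,k_1,k_3)$; (3) (triad) for $t\in\mathbb N$, with $n=3t$, the integer with digit string $2^{t-1}\,1\,3^{t}\,1^{t-1}\,2$, with Kaprekar index $(0,t,t,t)$. Cycles: (4) (single-parameter) for $t\in\mathbb N$, with $n=3t+8$, the cycle of length $3$ $$3\,2^{t-1}\,110\,3^{t+2}\,222\,1^{t}\mapsto 3\,2^{t+1}\,1\,3^{t+2}\,1^{t+3}\mapsto 2^{t+3}\,0\,3^{t}\,2\,1^{t+2}\,2\mapsto 3\,2^{t-1}\,110\,3^{t+2}\,222\,1^{t},$$ with Kaprekar indices $(1,t+2,t+2,t+3)\mapsto(0,t+4,t+1,t+3)\mapsto(1,t+2,t+5,t)\mapsto(1,t+2,t+2,t+3)$; (5) with $n=2$, the cycle of length $2$: $03\mapsto21\mapsto03$,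 with Kaprekar indices $(1,0,0,1)\mapsto(0,1,1,0)\mapsto(1,0,0,1)$; (6) with $n=4$, the cycle of length $2$: $2022\mapsto1332\mapsto2022$, with Kaprekar indices $(1,0,3,0)\mapsto(0,1,1,2)\mapsto(1,0,3,0)$; (7) with $n=5$, the cycle of length $2$: $20322\mapsto23331\mapsto20322$, with Kaprekar indices $(1,0,3,1)\mapsto(0,1,1,3)\mapsto(1,0,3,1)$; (8) with $n=8$, the cycle of length $3$: $22033212\mapsto31333311\mapsto22133112\mapsto22033212$, with Kaprekar indices $(1,1,4,2)\mapsto(0,3,0,5)\mapsto(0,3,3,2)\mapsto(1,1,4,2)$.
   Context: Integers with digit-count $n$ in base $b$ are identified with strings of exactly $n$ base-$b$ digits (leading zeros allowed). If $a_0\le a_1\le\cdots\le a_{n-1}$ are the base-$b$ digits of $x$ in ascending order, the Kaprekar transformation is $T_{b,n}(x)=\sum_{j=0}^{n-1}a_jb^j-\sum_{j=0}^{n-1}a_jb^{n-1-j}$, again regarded as an $n$-digit string. A repdigit is an integer all of whose $n$ digits are equal; repdigits are excluded from consideration. A fixed point is a non-repdigit $x$ with $T_{b,n}(x)=x$. A cycle of length $l\ge2$ is a set of $l$ distinct non-repdigit integers permuted cyclically by $T_{b,n}$. The Kaprekar index of $x$ is the $b$-tuple $(k_0,\ldots,k_{b-1})$, where $k_i$ is the number of occurrences of the digit $i$ among the $n$ digits; $T_{b,n}(x)$ depends only on the Kaprekar index of $x$. In digit strings, $i^{m}$ denotes the digit $i$ repeated $m$ times (absent if $m=0$), and juxtaposition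 is concatenation; $x\mapsto y$ means $y=T_{4,n}(x)$. $\mathbb N=\{1,2,3,\ldots\}$. *)

(* Defs.v *)
From mathcomp Require Import all_boot finmap.

Set Implicit Arguments.
Unset Strict Implicit.
Unset Printing Implicit Defensive.

(* Digit strings are sequences with the most significant digit first.  An      *)
(* integer with digit-count n in base b is a natural number x < b ^ n.         *)

Definition digits (b n x : nat) : seq nat :=
  rev (mkseq (fun j => (x %/ b ^ j) %% b) n).

Definition int_of_digits (b : nat) (s : seq nat) : nat :=
  foldl (fun v d => v * b + d) 0 s.

(* The difference is that of natural numbers, but it is never truncated: as    *)
(* a is ascending, the second sum is at most the first.                        *)
Definition kaprekar (b n x : nat) : nat :=
  let a := sort leq (digits b n x) in
  \sum_(j < n) nth 0 a j * b ^ j - \sum_(j < n) nth 0 a j * b ^ (n - 1 - j).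

Definition repdigit (b n x : nat) : bool := constant (digits b n x).

Definition kaprekar_index (b n x : nat) : b.-tuple nat :=
  [tuple count_mem (val i) (digits b n x) | i < b].

Definition fixed_point (b n x : nat) : Prop :=
  [/\ x < b ^ n, ~~ repdigit b n x & kaprekar b n x = x].

(* A cycle is an unordered set C; the sequence c enumerates it in the cyclic   *)
(* order in which the transformation permutes it.                              *)
Definition kaprekar_cycle (b n l : nat) (C : {fset nat}) : Prop :=
  [/\ 2 <= l,
      #|` C|%fset = l,
      forall x, x \in C -> x < b ^ n /\ ~~ repdigit b n x
    & exists c : seq nat,
        [/\ uniq c, fcycle (kaprekar b n) c & C = [fset x in c]%fset]].

(* listed_fixed n s k: the digit string s, with Kaprekar index k, occurs in    *)
(* the list of fixed points for digit-count n in base 4.                       *)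
Inductive listed_fixed : nat -> seq nat -> 4.-tuple nat -> Prop :=
| Symmetric (k0 k1 : nat) of 1 <= k0 & 1 <= k1 :
    listed_fixed (2 * (k0 + k1))
      (nseq k0 3 ++ nseq (k1 - 1) 1 ++ [:: 0] ++ nseq k1 2
         ++ nseq (k0 - 1) 0 ++ [:: 1])
      [tuple k0; k1; k1; k0]
| AlmostSymmetric (k0 k1 k3 : nat) of 1 <= k0 & k0 < k3 & k3 < k0 + k1 :
    let alpha := k3 - k0 in
    listed_fixed (k0 + 2 * k1 + k3)
      (nseq k0 3 ++ nseq alpha 2 ++ nseq (k1 - alpha - 1) 1 ++ [:: 0]
         ++ nseq alpha 3 ++ nseq (k1 - alpha) 2 ++ nseq alpha 1
         ++ nseq (k0 - 1) 0 ++ [:: 1])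
      [tuple k0; k1; k1; k3]
| Triad (t : nat) of 1 <= t :
    listed_fixed (3 * t)
      (nseq (t - 1) 2 ++ [:: 1] ++ nseq t 3 ++ nseq (t - 1) 1 ++ [:: 2])
      [tuple 0; t; t; t].

(* listed_cycle n l ss ks: the cycle of length l whose successive members have *)
(* the digit strings ss and the Kaprekar indices ks occurs in the list of      *)
(* cycles for digit-count n in base 4.                                         *)
Inductive listed_cycle :
    nat -> nat -> seq (seq nat) -> seq (4.-tuple nat) -> Prop :=
| SingleParameter (t : nat) of 1 <= t :
    listed_cycle (3 * t + 8) 3
      [:: [:: 3] ++ nseq (t - 1) 2 ++ [:: 1; 1; 0] ++ nseq (t + 2) 3
            ++ [:: 2; 2; 2] ++ nseq t 1;
          [:: 3] ++ nseq (t + 1) 2 ++ [:: 1] ++ nseq (t + 2) 3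
            ++ nseq (t + 3) 1;
          nseq (t + 3) 2 ++ [:: 0] ++ nseq t 3 ++ [:: 2] ++ nseq (t + 2) 1
            ++ [:: 2]]
      [:: [tuple 1; t + 2; t + 2; t + 3];
          [tuple 0; t + 4; t + 1; t + 3];
          [tuple 1; t + 2; t + 5; t]]
| Sporadic2 :
    listed_cycle 2 2
      [:: [:: 0; 3]; [:: 2; 1]]
      [:: [tuple 1; 0; 0; 1]; [tuple 0; 1; 1; 0]]
| Sporadic4 :
    listed_cycle 4 2
      [:: [:: 2; 0; 2; 2]; [:: 1; 3; 3; 2]]
      [:: [tuple 1; 0; 3; 0]; [tuple 0; 1; 1; 2]]
| Sporadic5 :
    listed_cycle 5 2
      [:: [:: 2; 0; 3; 2; 2]; [:: 2; 3; 3; 3; 1]]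
      [:: [tuple 1; 0; 3; 1]; [tuple 0; 1; 1; 3]]
| Sporadic8 :
    listed_cycle 8 3
      [:: [:: 2; 2; 0; 3; 3; 2; 1; 2];
          [:: 3; 1; 3; 3; 3; 3; 1; 1];
          [:: 2; 2; 1; 3; 3; 1; 1; 2]]
      [:: [tuple 1; 1; 4; 2]; [tuple 0; 3; 0; 5]; [tuple 0; 3; 3; 2]].

(* Main.v *)
(* Subtracting the ascending from the descending digit string gives the digit
   differences 3^p 2^q 1^r 0^s (-1)^r (-2)^q (-3)^p, so T x, and hence its index,
   is piecewise linear in (p, q, r, s).  The number k0 of zeros does not increase,
   except that it may go from 0 to 1.  While k0 = a > 0 stays constant, the index
   has the shape (a, b, b, c) with a <= c, and b grows until c < a + b, where the
   index is fixed.  This reduces to the case k0 <= 1, where only the shapes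
   (1, m, m, c), (0, m, m, c), (1, b, b + 3, c) and (0, b + 3, b, c) occur; these
   soon reach an index of the list.  So every orbit, and in particular every
   cycle, meets the list. *)
Require Import Defs.
From mathcomp Require Import all_boot finmap.
From mathcomp Require Import zify ring.

Set Implicit Arguments.
Unset Strict Implicit.
Unset Printing Implicit Defensive.

(** * Values of digit strings and of sorted strings *)

Lemma int_of_digits_cat b s1 s2 :
  int_of_digits b (s1 ++ s2) =
  int_of_digits b s1 * b ^ size s2 + int_of_digits b s2.
Proof.
rewrite /int_of_digits foldl_cat; move: (foldl _ 0 s1) => v.
elim/last_ind: s2 => [|s d IH]; first by rewrite muln1 addn0.
by rewrite -!cats1 !foldl_cat /= IH size_cat addn1 expnSr; ring.
Qed.

(** The witness u is the repunit with m ones in base [b.+1]. The existential form, instead of a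
    quotient by b, leaves polynomial identities that [ring] settles. *)
Lemma repunit b m : exists u,
  b.+1 ^ m = b * u + 1 /\ forall d, int_of_digits b.+1 (nseq m d) = d * u.
Proof.
elim: m => [|m [u [Eb Eu]]].
  by exists 0; split=> [|d]; rewrite ?muln0.
exists (b.+1 ^ m + u); split=> [|d]; first by rewrite expnS {1}Eb mulnDr Eb; ring.
by rewrite (nseqD 1) int_of_digits_cat Eu size_nseq /int_of_digits /=; ring.
Qed.

Lemma int_of_digits_mkseq b f n :
  int_of_digits b (rev (mkseq f n)) = \sum_(j < n) f j * b ^ j.
Proof.
elim: n => [|n IH]; first by rewrite big_ord0.
rewrite mkseqS rev_rcons -cat1s int_of_digits_cat IH big_ord_recr /= addnC.
by rewrite size_rev size_mkseq /int_of_digits /= mul0n add0n.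
Qed.

Lemma int_of_digits_sum b s :
  int_of_digits b s = \sum_(j < size s) nth 0 s j * b ^ (size s - 1 - j).
Proof.
rewrite -{1}[s]revK -{1}[rev s](mkseq_nth 0) int_of_digits_mkseq size_rev.
rewrite (reindex_inj rev_ord_inj); apply: eq_bigr => j _ /=.
have lt_j := ltn_ord j.
rewrite nth_rev; last by lia.
by congr (nth _ _ _ * _ ^ _); lia.
Qed.

Lemma size_digits b n x : size (digits b n x) = n.
Proof. by rewrite size_rev size_mkseq. Qed.

Lemma int_of_digitsK b n s : 0 < b -> size s = n -> all (fun d => d < b) s ->
  digits b n (int_of_digits b s) = s /\ int_of_digits b s < b ^ n.
Proof.
move=> b0 <- {n}; elim/last_ind: s => [|s d IH] //.
rewrite all_rcons => /andP[ltd /IH [IHd IHlt]].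
have E : int_of_digits b (rcons s d) = int_of_digits b s * b + d.
  by rewrite -cats1 int_of_digits_cat /= expn1 /int_of_digits /= mul0n add0n.
rewrite E size_rcons; split; last first.
  by rewrite expnSr; nia.
rewrite /digits -[RHS]revK rev_rcons -[in RHS]IHd /digits revK.
rewrite /mkseq /= expn0 divn1 modnMDl modn_small //.
(* Once the lowest digit d is split off, digit j + 1 of v * b + d is digit j of v. *)
congr rev; congr (_ :: _); rewrite -(addn0 1) iotaDl -map_comp.
apply: eq_map => j /=; rewrite add1n expnS divnMA divnMDl //.
by rewrite (divn_small ltd) addn0.
Qed.

Lemma digits_lt b n x : 0 < b -> all (fun d => d < b) (digits b n x).
Proof.
by move=> b0; rewrite all_rev; apply/allP => _ /mapP[j _ ->]; rewrite ltn_pmod.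
Qed.

(** Both sides are sorted, so it suffices to compare the multiplicity of each digit. *)
Lemma sort_leq4 s : all (fun d => d < 4) s ->
  sort leq s = nseq (count_mem 0 s) 0 ++ nseq (count_mem 1 s) 1
               ++ nseq (count_mem 2 s) 2 ++ nseq (count_mem 3 s) 3.
Proof.
move=> s4; apply: (sorted_eq leq_trans anti_leq).
- exact: (sort_sorted leq_total).
- rewrite (sorted_pairwise leq_trans) !pairwise_cat !allrel_catr.
  have nseq_asc m d : pairwise leq (nseq m d).
    by elim: m => //= m ->; rewrite all_nseq leqnn orbT.
  have nseq_rel m d m' d' : d <= d' -> allrel leq (nseq m d) (nseq m' d').
    by move=> le_d; apply/allrelP => a b /nseqP[-> _] /nseqP[-> _].
  by rewrite !nseq_asc !nseq_rel.
rewrite perm_sort; apply/allP => d _; apply/eqP; rewrite /= !count_cat !count_nseq.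
have [|d_ge4] := ltnP d 4; first by case: d => [|[|[|[|]]]] //= _; lia.
rewrite (count_memPn _) ?eqn_leq; first by case: d d_ge4 => [|[|[|[|]]]].
by apply/negP => /(allP s4); rewrite ltnNge d_ge4.
Qed.

Lemma size_leq4 s : all (fun d => d < 4) s ->
  size s = count_mem 0 s + count_mem 1 s + count_mem 2 s + count_mem 3 s.
Proof.
move=> s4; rewrite -(size_sort leq) sort_leq4 // !size_cat !size_nseq; lia.
Qed.

Lemma kaprekarE b n x (a := sort leq (digits b n x)) :
  kaprekar b n x = int_of_digits b (rev a) - int_of_digits b a.
Proof.
have sa : size a = n by rewrite size_sort size_digits.
have -> : rev a = rev (mkseq (nth 0 a) n) by rewrite -sa mkseq_nth.
by rewrite int_of_digits_mkseq [int_of_digits b a]int_of_digits_sum sa.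
Qed.

(** * The string of digit differences *)

(* Each of the three boundaries between the digit blocks of the sorted string,
   at distance m_i from the nearer end, contributes 1 to the differences at the
   outer m_i positions.  Hence p, p + q and p + q + r are m0, m1, m2 in increasing
   order, as expressed by their minimum, maximum and sum; s counts the zeros in
   the middle. *)
Definition gaps (k0 k1 k2 k3 p q r s : nat) :=
  let m0 := minn k0 (k1 + k2 + k3) in
  let m1 := minn (k0 + k1) (k2 + k3) in
  let m2 := minn (k0 + k1 + k2) k3 in
  p = minn m0 (minn m1 m2) /\ p + q + r = maxn m0 (maxn m1 m2) /\
  p + (p + q) + (p + q + r) = m0 + m1 + m2 /\
  k0 + k1 + k2 + k3 = 2 * (p + q + r) + s.

Lemma exists_gaps k0 k1 k2 k3 : exists p q r s, gaps k0 k1 k2 k3 p q r s.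
Proof.
rewrite /gaps; set m0 := minn k0 _; set m1 := minn (k0 + k1) _.
set m2 := minn _ k3; set n := _ + k3.
have : 2 * m0 <= n /\ 2 * m1 <= n /\ 2 * m2 <= n by rewrite /m0 /m1 /m2 /n; lia.
move: m0 m1 m2 n => m0 m1 m2 n le_n.
pose e := maxn m0 (maxn m1 m2); pose p := minn m0 (minn m1 m2).
(* The median is m0 + m1 + m2 - e - p; q is the median minus p, and r is e minus the median. No
   subtraction truncates, since every m_i is at most half of n. *)
exists p, (m0 + m1 + m2 - e - p - p), (e + e + p - m0 - m1 - m2), (n - 2 * e).
rewrite /p /e; clear p e.
by case: (leqP m1 m2) => ?; case: (leqP m0 m1) => ?; case: (leqP m0 m2) => ?; lia.
Qed.

(* Propagating the borrows through 3^p 2^q 1^r 0^s (-1)^r (-2)^q (-3)^p decrements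
   the last positive difference and turns the zeros into 3. *)
Definition top p q r :=
  if 0 < r then nseq p 3 ++ nseq q 2 ++ nseq r.-1 1 ++ [:: 0]
  else if 0 < q then nseq p 3 ++ nseq q.-1 2 ++ [:: 1]
  else nseq p.-1 3 ++ [:: 2].

Definition bottom p q r :=
  if 0 < p then nseq r 2 ++ nseq q 1 ++ nseq p.-1 0 ++ [:: 1]
  else if 0 < q then nseq r 2 ++ nseq q.-1 1 ++ [:: 2]
  else nseq r.-1 2 ++ [:: 3].

Definition diff_string p q r s := top p q r ++ nseq s 3 ++ bottom p q r.

(** Three times the value of 3^p 2^q 1^r telescopes to 3 * 4^(p+q+r) - 4^(q+r) - 4^r - 1, and the
    borrowed unit takes away 3 more. So one formula covers all three forms of [top]. *)
Lemma int_of_top p q r : 0 < p + q + r ->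
  3 * int_of_digits 4 (top p q r) + 4 ^ (q + r) + 4 ^ r + 4 =
  3 * 4 ^ (p + q + r).
Proof.
have [P [EP VP]] := repunit 3 p; have [Q [EQ VQ]] := repunit 3 q.
have [R [ER VR]] := repunit 3 r; rewrite /top.
case: r ER VR => [|r] ER VR; last first.
  move=> _; have [R' [ER' VR']] := repunit 3 r.
  rewrite !int_of_digits_cat !size_cat !size_nseq /= !expnD !expnS !expn0.
  by rewrite VP VQ VR' EP EQ ER' /int_of_digits /=; ring.
case: q EQ VQ => [|q] EQ VQ; last first.
  move=> _; have [Q' [EQ' VQ']] := repunit 3 q.
  rewrite !int_of_digits_cat !size_cat !size_nseq /= !expnD !expnS !expn0.
  by rewrite VP VQ' EP EQ' /int_of_digits /=; ring.
case: p EP VP => [|p] EP VP // _.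
have [P' [EP' VP']] := repunit 3 p.
rewrite !int_of_digits_cat !addn0 /= !expnS !expn0.
by rewrite VP' EP' /int_of_digits /=; ring.
Qed.

(** [bottom] represents 4^(p+q+r) minus the value of 1^r 2^q 3^p: every digit is complemented to 3,
    then 1 is added to the last one. *)
Lemma int_of_bottom p q r : 0 < p + q + r ->
  3 * int_of_digits 4 (bottom p q r) + 4 ^ (q + p) + 4 ^ p =
  2 * 4 ^ (p + q + r) + 3.
Proof.
have [P [EP VP]] := repunit 3 p; have [Q [EQ VQ]] := repunit 3 q.
have [R [ER VR]] := repunit 3 r; rewrite /bottom.
case: p EP VP => [|p] EP VP; last first.
  move=> _; have [P' [EP' VP']] := repunit 3 p.
  rewrite !int_of_digits_cat !size_cat !size_nseq /= !expnD !expnS !expn0.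
  by rewrite VR VQ VP' ER EQ EP' /int_of_digits /=; ring.
case: q EQ VQ => [|q] EQ VQ; last first.
  move=> _; have [Q' [EQ' VQ']] := repunit 3 q.
  rewrite !int_of_digits_cat !size_cat !size_nseq /= !expnD !expnS !expn0.
  by rewrite VR VQ' ER EQ' /int_of_digits /=; ring.
case: r ER VR => [|r] ER VR // _.
have [R' [ER' VR']] := repunit 3 r.
rewrite !int_of_digits_cat /= !expnS !expn0.
by rewrite VR' ER' /int_of_digits /=; ring.
Qed.

Lemma size_bottom p q r : 0 < p + q + r -> size (bottom p q r) = p + q + r.
Proof.
rewrite /bottom; case: p => [|p]; case: q => [|q]; case: r => [|r] //= _;
  by do ?rewrite /= (size_cat, size_nseq); lia.
Qed.

Lemma size_top p q r : 0 < p + q + r -> size (top p q r) = p + q + r.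
Proof.
rewrite /top; case: p => [|p]; case: q => [|q]; case: r => [|r] //= _;
  by do ?rewrite /= (size_cat, size_nseq); lia.
Qed.

Lemma int_of_diff_string p q r s : 0 < p + q + r ->
  3 * int_of_digits 4 (diff_string p q r s)
    + (4 ^ p + 4 ^ (p + q) + 4 ^ (p + q + r))
    + (4 ^ (s + p + q + r) + 4 ^ (s + p + q + r + r) + 4 ^ (s + p + q + r + r + q))
  = 3 * 4 ^ (2 * (p + q + r) + s) + 3.
Proof.
move=> pqr; have [S [ES VS]] := repunit 3 s.
have := int_of_top pqr; have := int_of_bottom pqr.
rewrite /diff_string !int_of_digits_cat size_cat size_bottom // size_nseq VS.
rewrite !mulnDr !mul2n -!addnn !expnD ES.
set B := int_of_digits _ _; set T := int_of_digits _ _.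
move: (4 ^ p) (4 ^ q) (4 ^ r) => P Q R HB HT.
have HT' : 3 * T * ((3 * S + 1) * (P * Q * R))
  + (Q * R + R + 4) * ((3 * S + 1) * (P * Q * R))
  = 3 * (P * Q * R) * ((3 * S + 1) * (P * Q * R)) by rewrite -HT; ring.
lia.
Qed.

(** Minimum, maximum and sum force e1 to be the median, so the e_i are a permutation of the m_i. *)
Lemma sorted_sum3 (f : nat -> nat) m0 m1 m2 e0 e1 e2 :
  e0 = minn m0 (minn m1 m2) -> e2 = maxn m0 (maxn m1 m2) ->
  e0 + e1 + e2 = m0 + m1 + m2 ->
  f e0 + f e1 + f e2 = f m0 + f m1 + f m2.
Proof.
case: (leqP m1 m2) => ?; case: (leqP m0 m1) => ?; case: (leqP m0 m2) => ?.
all: move=> -> -> E; try (exfalso; clear f; lia).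
all: first [ have -> : e1 = m0 by clear f; lia
  | have -> : e1 = m1 by clear f; lia | have -> : e1 = m2 by clear f; lia ].
all: ring.
Qed.

(** Multiplied by 3, each constant block becomes a difference of powers of 4, and only the powers at
    block boundaries and ends survive. *)
Lemma int_of_sorted k0 k1 k2 k3
    (a := nseq k0 0 ++ nseq k1 1 ++ nseq k2 2 ++ nseq k3 3) :
  3 * int_of_digits 4 (rev a) + (4 ^ k0 + 4 ^ (k0 + k1) + 4 ^ (k0 + k1 + k2))
    + (4 ^ (k1 + k2 + k3) + 4 ^ (k2 + k3) + 4 ^ k3)
  = 3 * int_of_digits 4 a + 3 * 4 ^ (k0 + k1 + k2 + k3) + 3.
Proof.
have rev_nseq m (d : nat) : rev (nseq m d) = nseq m d.
  elim: m => // m IH; rewrite -{1}[m.+1]addn1 nseqD rev_cat IH; by [].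
rewrite /a !rev_cat !rev_nseq !int_of_digits_cat !size_cat !size_nseq.
have [A [EA VA]] := repunit 3 k0; have [B [EB VB]] := repunit 3 k1.
have [C [EC VC]] := repunit 3 k2; have [D [ED VD]] := repunit 3 k3.
by rewrite !expnD VA VB VC VD EA EB EC ED; ring.
Qed.

Lemma int_of_diff_string_sorted k0 k1 k2 k3 p q r s
    (a := nseq k0 0 ++ nseq k1 1 ++ nseq k2 2 ++ nseq k3 3) :
  gaps k0 k1 k2 k3 p q r s -> 0 < p + q + r ->
  int_of_digits 4 (rev a) = int_of_digits 4 a + int_of_digits 4 (diff_string p q r s).
Proof.
move=> [E0 [E2 [E1 En]]] pqr.
have := int_of_diff_string s pqr; have := int_of_sorted k0 k1 k2 k3; rewrite -/a.
(* A boundary at distance e from one end contributes [g n e], which is the same when e is measured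
   from the other end. This removes the minima of [gaps]. *)
pose g n e := 4 ^ e + 4 ^ (n - e).
have gmin n e e' : e + e' = n -> g n (minn e e') = 4 ^ e + 4 ^ e'.
  by move=> <-; rewrite /g; case: leqP => _; rewrite ?addnK ?addKn // addnC.
have := sorted_sum3 (g (k0 + k1 + k2 + k3)) E0 E2 E1.
rewrite !gmin; [|lia..]; rewrite En /g.
have -> : 2 * (p + q + r) + s - p = s + p + q + r + r + q by lia.
have -> : 2 * (p + q + r) + s - (p + q) = s + p + q + r + r by lia.
have -> : 2 * (p + q + r) + s - (p + q + r) = s + p + q + r by lia.
by clear E0 E1 E2 En; lia.
Qed.

Definition counts s := (count_mem 0 s, count_mem 1 s, count_mem 2 s, count_mem 3 s).

Lemma kaprekar_diff_string n x k0 k1 k2 k3 p q r s :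
  counts (digits 4 n x) = (k0, k1, k2, k3) ->
  gaps k0 k1 k2 k3 p q r s -> 0 < p + q + r ->
  kaprekar 4 n x = int_of_digits 4 (diff_string p q r s).
Proof.
move=> [E0 E1 E2 E3] gap pqr; rewrite kaprekarE sort_leq4 ?digits_lt //.
by rewrite E0 E1 E2 E3 (int_of_diff_string_sorted gap pqr) addKn.
Qed.

Lemma size_counts n x k0 k1 k2 k3 :
  counts (digits 4 n x) = (k0, k1, k2, k3) -> k0 + k1 + k2 + k3 = n.
Proof.
by case=> <- <- <- <-; rewrite -size_leq4 ?digits_lt ?size_digits.
Qed.

Lemma diff_stringK k0 k1 k2 k3 p q r s (n := k0 + k1 + k2 + k3) :
  gaps k0 k1 k2 k3 p q r s -> 0 < p + q + r ->
  digits 4 n (int_of_digits 4 (diff_string p q r s)) = diff_string p q r s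
  /\ int_of_digits 4 (diff_string p q r s) < 4 ^ n.
Proof.
move=> gap pqr; apply: int_of_digitsK => //.
  rewrite /diff_string !size_cat size_top // size_bottom // size_nseq /n.
  by case: gap => _ [_ [_ ->]]; lia.
by rewrite /diff_string /top /bottom; do 4?[case: ifP => _];
  rewrite !all_cat ?all_nseq /= ?orbT.
Qed.

(** * The dynamics on Kaprekar indices *)

Definition diff_index p q r s :=
  if 0 < p then
    if 0 < r then (p, q + r, q + r, p + s)
    else if 0 < q then (p.-1, q.+2, q.-1, p + s)
    else (p.-1, 1, 1, p.-1 + s)
  else if 0 < q then
    if 0 < r then (1, (q + r).-2, (q + r).+1, s) else (0, q, q, s)
  else (1, r.-1, r.-1, s.+1).

Lemma counts_diff_string p q r s : 0 < p + q + r ->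
  counts (diff_string p q r s) = diff_index p q r s.
Proof.
move=> pqr; rewrite /counts /diff_string /top /bottom /diff_index.
case: p pqr => [|p]; case: q => [|q]; case: r => [|r] //= _;
 congr (_, _, _, _); do ?rewrite /= (count_cat, count_nseq) /=; lia.
Qed.

(* The indices of the listed fixed points, and one index of each listed cycle. *)
Definition settled k0 k1 k2 k3 : Prop :=
  (k1 = k2 /\ 1 <= k0 /\ k0 <= k3 /\ k3 < k0 + k1)
  \/ (k0 = 0 /\ k1 = k2 /\ k2 = k3 /\ 1 <= k1)
  \/ (k0 = 1 /\ k1 = k2 /\ 3 <= k1 /\ k3 = k1 + 1)
  \/ (k0 = 1 /\ k1 = 0 /\ k2 = 0 /\ k3 = 1)
  \/ (k0 = 1 /\ k1 = 0 /\ k2 = 3 /\ k3 <= 1)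
  \/ (k0 = 1 /\ k1 = 1 /\ k2 = 4 /\ k3 = 2).

(** The orbit is followed on indices alone, which reduces the whole analysis to linear
    arithmetic. *)
Inductive settles : nat * nat * nat * nat -> Prop :=
| SettlesNow k0 k1 k2 k3 of settled k0 k1 k2 k3 : settles (k0, k1, k2, k3)
| SettlesNext k0 k1 k2 k3 p q r s of
    gaps k0 k1 k2 k3 p q r s & 0 < p + q + r & settles (diff_index p q r s) :
    settles (k0, k1, k2, k3).

(** The branches of [diff_index] become linear constraints, so that the image may be given in any
    convenient form and checked by [lia]. *)
Lemma settles_next p q r s l0 l1 l2 l3 k0 k1 k2 k3 :
  gaps k0 k1 k2 k3 p q r s ->
  (0 < p /\ 0 < r /\ l0 = p /\ l1 = q + r /\ l2 = q + r /\ l3 = p + s)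
  \/ (0 < p /\ 0 < q /\ r = 0 /\ l0 = p - 1 /\ l1 = q + 2 /\ l2 = q - 1 /\ l3 = p + s)
  \/ (0 < p /\ q = 0 /\ r = 0 /\ l0 = p - 1 /\ l1 = 1 /\ l2 = 1 /\ l3 = p - 1 + s)
  \/ (p = 0 /\ 0 < q /\ 0 < r /\ l0 = 1 /\ l1 = q + r - 2 /\ l2 = q + r + 1 /\ l3 = s)
  \/ (p = 0 /\ 0 < q /\ r = 0 /\ l0 = 0 /\ l1 = q /\ l2 = q /\ l3 = s)
  \/ (p = 0 /\ q = 0 /\ 0 < r /\ l0 = 1 /\ l1 = r - 1 /\ l2 = r - 1 /\ l3 = s + 1) ->
  settles (l0, l1, l2, l3) -> settles (k0, k1, k2, k3).
Proof.
move=> gap cases sl; apply: (SettlesNext gap); first by clear gap; lia.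
rewrite (_ : diff_index p q r s = (l0, l1, l2, l3)) // /diff_index.
clear gap.
case: p cases => [|p]; case: q => [|q]; case: r => [|r] //= cases.
all: repeat congr pair; lia.
Qed.

(** Innermost occurrences go first, so that only linear terms are compared; contradictory branches
    are cut at once. *)
Ltac split_minn_maxn :=
  repeat match goal with
  | |- context [minn ?a ?b] =>
    lazymatch a with context [minn] => fail | _ =>
    lazymatch b with context [minn] => fail | _ =>
      case: (leqP a b) => ?; try (exfalso; lia) end end
  | |- context [maxn ?a ?b] =>
    lazymatch a with context [maxn] => fail | _ =>
    lazymatch b with context [maxn] => fail | _ =>
      case: (leqP a b) => ?; try (exfalso; lia) end end
  end.
Ltac choose_case :=
  first [left; repeat split; lia | right; choose_case | repeat split; lia].
(* [l0, ..., l3] is the index of the image of an integer with gaps [p, q, r, s]. *)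
Ltac advance p q r s l0 l1 l2 l3 :=
  apply: (@settles_next p q r s l0 l1 l2 l3);
    [rewrite /gaps; split_minn_maxn; repeat split; lia | choose_case |].
Ltac by_settled := apply: SettlesNow; rewrite /settled; lia.

Lemma settles_one_zero m c : 0 < m -> 0 < c -> settles (1, m, m, c).
Proof.
have [N] := ubnP c; elim: N m c => // N IH m c ltN m0 c0.
have [cm|cm] := leqP c m; first by_settled.
(* For c = m + 1 and m at least 3 this is an index of the single-parameter cycle with t = m - 2; m =
   1 and m = 2 lead to the sporadic cycles of digit-counts 5 and 8. *)
have [c1|c1] : c = m + 1 \/ m + 2 <= c by lia.
  have [m3|[m1|m2]] : 3 <= m \/ m = 1 \/ m = 2 by lia.
  - by_settled.
  - by subst; advance 1 1 0 1 0 3 0 2;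
      advance 0 2 0 1 0 2 2 1; advance 0 1 1 1 1 0 3 1; by_settled.
  - by subst; advance 1 2 0 2 0 4 1 3;
      advance 0 3 1 0 1 2 5 0; advance 0 1 2 2 1 1 4 2; by_settled.
(* For large c a step doubles m and lowers c by 2 * m, so the induction applies; otherwise one step
   gives a fixed index. *)
have [c2|c2] := leqP (2 * m).+1 c.
  by advance 1 m m (c - 1 - 2 * m) 1 (2 * m) (2 * m) (c - 2 * m); apply: IH; lia.
by advance 1 m (c - 1 - m) (2 * m + 1 - c) 1 (c - 1) (c - 1) (2 * m + 2 - c); by_settled.
Qed.

(** If 0 < c <= b or b + 2 <= c, one step gives the shape (1, m, m, c'). Only c = 0 and c = b + 1
    take longer. *)
Lemma settles_diff3 b c : settles (1, b, b + 3, c).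
Proof.
have D1 m d : 0 < d -> d <= m -> settles (1, m, m + 3, d).
  by move=> d0 dm; advance 1 (d - 1) (m + 1 - d) (d + 2) 1 m m (d + 3);
    apply: settles_one_zero; lia.
have D3 m d : m + 2 <= d -> settles (1, m, m + 3, d).
  move=> dm; have [d4|d4] := leqP d (2 * m + 4).
    by advance 1 m (d - 1 - m) (2 * m + 4 - d) 1 (d - 1) (d - 1) (2 * m + 5 - d);
      apply: settles_one_zero; lia.
  by advance 1 m (m + 3) (d - 4 - 2 * m) 1 (2 * m + 3) (2 * m + 3) (d - 3 - 2 * m);
      apply: settles_one_zero; lia.
have D2 m : settles (1, m, m + 3, 0).
  have [m0|[m2|m3]] : m = 0 \/ m = 2 \/ 1 <= m /\ m <> 2 by lia.
  - by_settled.
  - by subst; advance 0 1 2 2 1 1 4 2; by_settled.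
  advance 0 1 m 2 1 (m - 1) (m - 1 + 3) 2.
  by have [m1|m1] := leqP m 1; [apply: D3 | apply: D1]; lia.
have [c0|c0] := posnP c; first by rewrite c0.
have [cb|cb] := leqP c b; first exact: D1.
have [cb2|cb2] := leqP (b + 2) c; first exact: D3.
have Ec : c = b + 1 by lia.
(* b = 0 is on the cycle of digit-count 5, and b = 1 runs once around that of digit-count 8. From b
   = 2 on, the zero is lost and regained, and the last entry is then small enough for [D1] or
   [D2]. *)
have [b0|[b1|[b2|b3]]] : b = 0 \/ b = 1 \/ b = 2 \/ 3 <= b by lia.
- by_settled.
- by subst; advance 1 1 0 4 0 3 0 5;
    advance 0 3 0 2 0 3 3 2; advance 0 2 1 2 1 1 4 2; by_settled.
- subst; advance 1 2 0 5 0 4 1 6; advance 0 4 1 1 1 3 6 1; exact: D1.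
advance 1 b 0 (b + 3) 0 (b + 2) (b - 1) (b + 4).
advance 0 (b + 2) 2 (b - 3) 1 (b + 2) (b + 2 + 3) (b - 3).
have [->|b4] : b = 3 \/ 4 <= b by lia.
  exact: D2.
by apply: D1; lia.
Qed.

(** Apart from the triad c = m, the next index has exactly one zero and one of the two shapes
    treated above, or is (1, 0, 0, 1). *)
Lemma settles_no_zero m c : 0 < m -> settles (0, m, m, c).
Proof.
move=> m0; have [cm|[cm|[c0|[c1 c2]]]] :
  c = m \/ m < c \/ c = 0 \/ (0 < c /\ c < m) by lia.
- by_settled.
- have [c2|c2] := leqP c (2 * m).
    by advance 0 m (c - m) (2 * m - c) 1 (c - 2) (c - 2 + 3) (2 * m - c); exact: settles_diff3.
  by advance 0 m m (c - 2 * m) 1 (2 * m - 2) (2 * m - 2 + 3) (c - 2 * m); exact: settles_diff3.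
- advance 0 0 m 0 1 (m - 1) (m - 1) 1.
  by have [m1|m1] := leqP m 1; [by_settled | apply: settles_one_zero; lia].
- by advance 0 c (m - c) c 1 (m - 2) (m - 2 + 3) c; exact: settles_diff3.
Qed.

Lemma settles_no_zero_diff3 b c : 0 < c -> settles (0, b + 3, b, c).
Proof.
move=> c0; have [cb|cb] := leqP (b + 3) c.
  have [r0|[r1|r1]] : (c = b + 3 \/ b = 0) \/ (0 < b /\ b + 3 < c /\ c <= 2 * b + 3)
     \/ (0 < b /\ 2 * b + 3 < c) by lia.
  - by advance 0 (b + 3) 0 (c - 3) 0 (b + 3) (b + 3) (c - 3); apply: settles_no_zero; lia.
  - by advance 0 (b + 3) (c - b - 3) (2 * b + 3 - c) 1 (c - 2) (c - 2 + 3) (2 * b + 3 - c);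
      exact: settles_diff3.
  - by advance 0 (b + 3) b (c - 3 - 2 * b) 1 (2 * b + 1) (2 * b + 1 + 3) (c - 3 - 2 * b);
      exact: settles_diff3.
have [b0|b0] := posnP b.
  by advance 0 c 0 (3 - c) 0 c c (3 - c); exact: settles_no_zero.
have [c3|[c1|c2]] : 3 <= c \/ c = 1 \/ c = 2 by lia.
- by advance 0 c (b + 3 - c) (c - 3) 1 (b + 1) (b + 1 + 3) (c - 3); exact: settles_diff3.
- by advance 0 1 b 2 1 (b - 1) (b - 1 + 3) 2; exact: settles_diff3.
- by advance 0 2 b 1 1 b (b + 3) 1; exact: settles_diff3.
Qed.

(** These are the shapes of an image other than (1, b, b + 3, c). By induction on the number a of
    zeros: a step lowers it within the two shapes, or keeps it and yields the first shape, where an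
    inner induction on c applies. *)
Lemma settles_image_shapes a :
  (forall b c, a <= c -> 0 < a + b -> settles (a, b, b, c)) /\
  (forall b c, a < c -> settles (a, b + 3, b, c)).
Proof.
elim: a => [|a [IHS IHB]].
  by split=> b c *; [apply: settles_no_zero; lia | apply: settles_no_zero_diff3; lia].
have S b c : a < c -> settles (a.+1, b, b, c).
  have [N] := ubnP c; elim: N b c => // N IH b c ltN ac.
  have [b0|b0] := posnP b.
    by advance a.+1 0 0 (c - a - 1) a 1 1 (c - 1); apply: IHS; lia.
  (* In order: a fixed index; a step that loses a zero; a step to a fixed index; a step that doubles
     b and lowers c. *)
  have [c1|[c1|[c1|c1]]] : c < a.+1 + b \/ c = a.+1 + b \/
    (a.+1 + b < c /\ c <= a.+1 + 2 * b) \/ a.+1 + 2 * b < c by lia.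
  - by_settled.
  - by advance a.+1 b 0 b a (b - 1 + 3) (b - 1) c; apply: IHB.
  - by advance a.+1 b (c - a.+1 - b) (2 * b + a.+1 - c)
      a.+1 (c - a.+1) (c - a.+1) (2 * b + 2 * a.+1 - c); by_settled.
  - by advance a.+1 b b (c - a.+1 - 2 * b) a.+1 (2 * b) (2 * b) (c - 2 * b); apply: IH; lia.
split=> [b c ac _|b c ac]; first exact: S.
(* The excess of threes over zeros, renamed e below, is positive; it is compared with the number b +
   3 of ones. *)
have [e ->] : exists e, c = a.+1 + e.+1 by exists (c - a.+2); lia.
move: (e.+1) (ltn0Sn e) => {e ac} {}e e0.
have [eb|eb] := leqP (b + 3) e.
  have [r0|[r1|r1]] : (e = b + 3 \/ b = 0) \/ (0 < b /\ b + 3 < e /\ e <= 2 * b + 3)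
     \/ (0 < b /\ 2 * b + 3 < e) by lia.
  - by advance a.+1 (b + 3) 0 (e - 3) a (b + 2 + 3) (b + 2) (a.+1 + e - 3); apply: IHB; lia.
  - by advance a.+1 (b + 3) (e - b - 3) (2 * b + 3 - e) a.+1 e e (a.+1 + (2 * b + 3 - e));
      apply: S; lia.
  - by advance a.+1 (b + 3) b (e - 3 - 2 * b) a.+1 (2 * b + 3) (2 * b + 3)
        (a.+1 + (e - 3 - 2 * b)); apply: S; lia.
have [b0|b0] := posnP b.
  by advance a.+1 e 0 (3 - e) a (e - 1 + 3) (e - 1) (a.+1 + (3 - e)); apply: IHB; lia.
have [e3|e3] := leqP 3 e.
  by advance a.+1 e (b + 3 - e) (e - 3) a.+1 (b + 3) (b + 3) (a.+1 + (e - 3)); apply: S; lia.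
by advance a.+1 e b (3 - e) a.+1 (e + b) (e + b) (a.+1 + (3 - e)); apply: S; lia.
Qed.

(** A single step from any index with two distinct digits lands in one of the shapes already
    treated. *)
Lemma settles_all k0 k1 k2 k3 :
  maxn (maxn k0 k1) (maxn k2 k3) < k0 + k1 + k2 + k3 -> settles (k0, k1, k2, k3).
Proof.
move=> nonconst; have [p [q [r [s gap]]]] := exists_gaps k0 k1 k2 k3.
have pqr : 0 < p + q + r by move: gap; rewrite /gaps; lia.
apply: (SettlesNext gap pqr); clear gap nonconst; rewrite /diff_index.
have S a b c := (settles_image_shapes a).1 b c.
have B a b c := (settles_image_shapes a).2 b c.
case: p pqr => [|p]; case: q => [|q]; case: r => [|r] //= _.
- by apply: S.
- by apply: S.
- by rewrite (_ : (_ + _).+1 = (q.+1 + r.+1).-2 + 3); [exact: settles_diff3 | lia].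
- by apply: S; lia.
- by apply: S; lia.
- by rewrite (_ : q.+3 = q + 3); [apply: B | ]; lia.
- by apply: S; lia.
Qed.

(** * Index and repdigits through digit counts *)

Lemma kaprekar_indexE n x k0 k1 k2 k3 :
  counts (digits 4 n x) = (k0, k1, k2, k3) ->
  kaprekar_index 4 n x = [tuple k0; k1; k2; k3].
Proof.
case=> <- <- <- <-; apply: val_inj.
by rewrite /= !enum_ordSl enum_ord0.
Qed.

Lemma kaprekar_eq_index n x y :
  kaprekar_index 4 n x = kaprekar_index 4 n y -> kaprekar 4 n x = kaprekar 4 n y.
Proof.
rewrite (@kaprekar_indexE n x _ _ _ _ erefl) (@kaprekar_indexE n y _ _ _ _ erefl).
move=> /(congr1 val) [E0 E1 E2 E3]; rewrite !kaprekarE.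
by rewrite !sort_leq4 ?digits_lt // E0 E1 E2 E3.
Qed.

Lemma repdigit_counts n x k0 k1 k2 k3 :
  counts (digits 4 n x) = (k0, k1, k2, k3) ->
  repdigit 4 n x = (n <= maxn (maxn k0 k1) (maxn k2 k3)).
Proof.
case=> <- <- <- <-; rewrite /repdigit; set s := digits 4 n x.
have sn : size s = n := size_digits 4 n x.
have cle i : count_mem i s <= n by rewrite -sn count_size.
apply/(constantP 0)/idP => [[d Ed]|].
  have s4 : all (fun d => d < 4) s by exact: digits_lt.
  (* For the empty string d is arbitrary, so d < 4 can be derived only when n is positive. *)
  have [n0|n0] := posnP n; first by rewrite n0.
  have d4 : d < 4 by move: s4; rewrite Ed all_nseq sn eqn0Ngt n0.
  have : count_mem d s = n by rewrite Ed count_nseq /= eqxx mul1n sn.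
  by case: d d4 {Ed} => [|[|[|[|]]]] // _ E; rewrite -{1}E !leq_max leqnn ?orbT.
rewrite !leq_max => le_n.
have {le_n} [d] : exists d, n <= count_mem d s.
  by case/orP: le_n => /orP[le_n|le_n]; eexists; exact: le_n.
rewrite -sn => le_n.
have /all_pred1P : all (pred1 d) s.
  by rewrite all_count eqn_leq count_size le_n.
by exists d.
Qed.

(** * Transitions and verification of the list *)

Definition index4 := (nat * nat * nat * nat)%type.
Definition digit_count (k : index4) := let: (k0, k1, k2, k3) := k in k0 + k1 + k2 + k3.
Definition index_tuple (k : index4) : 4.-tuple nat :=
  let: (k0, k1, k2, k3) := k in [tuple k0; k1; k2; k3].
Definition nonrep (k : index4) :=
  let: (k0, k1, k2, k3) := k in maxn (maxn k0 k1) (maxn k2 k3) < k0 + k1 + k2 + k3.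

(** Integers of the first index are mapped to the string in the middle, whose own index comes
    last. *)
Inductive transition : index4 -> seq nat -> index4 -> Prop :=
| Transition k0 k1 k2 k3 p q r s of gaps k0 k1 k2 k3 p q r s & 0 < p + q + r :
    transition (k0, k1, k2, k3) (diff_string p q r s) (diff_index p q r s).

Lemma transition_counts k s k' : transition k s k' -> counts s = k'.
Proof. by case=> *; rewrite counts_diff_string. Qed.

Lemma transition_string n k s k' : transition k s k' -> digit_count k = n ->
  digits 4 n (int_of_digits 4 s) = s /\ int_of_digits 4 s < 4 ^ n.
Proof.
by case=> k0 k1 k2 k3 p q r t gap pqr <-; exact: diff_stringK.
Qed.

Lemma transition_index n k s k' : transition k s k' -> digit_count k = n ->
  kaprekar_index 4 n (int_of_digits 4 s) = index_tuple k'.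
Proof.
move=> tr En; have [Ed _] := transition_string tr En.
have := transition_counts tr; rewrite -{1}Ed; case: k' {tr} => [[[? ?] ?] ?].
exact: kaprekar_indexE.
Qed.

(** Obtained through the string s: it has [digit_count k] digits, and k' counts them. *)
Lemma transition_digit_count k s k' : transition k s k' -> digit_count k' = digit_count k.
Proof.
move=> tr; have [Ed _] := transition_string tr erefl.
have := transition_counts tr; rewrite -{1}Ed; case: k' {tr} => [[[? ?] ?] ?].
exact: size_counts.
Qed.

Lemma kaprekar_transition n x k s k' :
  counts (digits 4 n x) = k -> transition k s k' ->
  kaprekar 4 n x = int_of_digits 4 s.
Proof. by move=> Ek tr; case: tr Ek => *; apply: kaprekar_diff_string; eassumption. Qed.

Lemma transition2 n k s k' s' k'' : transition k s k' -> digit_count k = n ->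
  transition k' s' k'' ->
  kaprekar 4 n (int_of_digits 4 s) = int_of_digits 4 s'.
Proof.
move=> tr En; apply: kaprekar_transition.
by rewrite (transition_string tr En).1 (transition_counts tr).
Qed.

Lemma transition_nonrepdigit n k s k' : transition k s k' -> digit_count k = n ->
  nonrep k' -> ~~ repdigit 4 n (int_of_digits 4 s).
Proof.
move=> tr En; have := transition_counts tr; have := transition_digit_count tr.
rewrite -{1}(transition_string tr En).1; case: k' {tr} => [[[k0 k1] k2] k3].
by rewrite En => E /repdigit_counts ->; rewrite /nonrep -ltnNge -E.
Qed.

(** A transition from k' to itself makes s fixed: s is the image of index k' and has that index
    again. *)
Lemma listed_fixed_transition n s k : listed_fixed n s k ->
  exists k', [/\ transition k' s k', digit_count k' = n, nonrep k' & k = index_tuple k'].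
Proof.
case=> {n s k} [k0 k1 h0 h1|k0 k1 k3 h0 h1 h2 alpha|t h0].
- exists (k0, k1, k1, k0); split=> //=; try lia.
  have := @Transition k0 k1 k1 k0 k0 0 k1 0.
  rewrite /diff_string /top /bottom /diff_index h0 h1 /= !addn0 -!subn1 -!catA /=; apply.
    by rewrite /gaps; split_minn_maxn; lia.
  lia.
- exists (k0, k1, k1, k3); split=> //=; try lia.
  have := @Transition k0 k1 k1 k3 k0 alpha (k1 - alpha) alpha.
  rewrite /diff_string /top /bottom /diff_index h0 ifT; last by rewrite /alpha; lia.
  rewrite ifT; last by rewrite /alpha; lia.
  rewrite -!subn1 -!catA /= (_ : alpha + (k1 - alpha) = k1); last by rewrite /alpha; lia.
  rewrite (_ : k0 + alpha = k3); last by rewrite /alpha; lia.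
  apply; rewrite ?/gaps /alpha; last lia.
  by split_minn_maxn; lia.
- exists (0, t, t, t); split=> //=; try lia.
  have := @Transition 0 t t t 0 t 0 t.
  rewrite /diff_string /top /bottom /diff_index h0 /= -!subn1 -!catA /=; apply; last lia.
  by rewrite /gaps; split_minn_maxn; lia.
Qed.

(** Distinct indices make the members distinct. Each member is presented as the image of some index
    k, which yields its exact digits and its bound. *)
Lemma transitions_cycle n ss ks l :
  1 < l -> size ss = l ->
  fcycle (kaprekar 4 n) (map (int_of_digits 4) ss) ->
  uniq (map index_tuple ks) -> size ks = l ->
  (forall i, i < l -> exists k, [/\ transition k (nth [::] ss i) (nth (0, 0, 0, 0) ks i),
     digit_count k = n & nonrep (nth (0, 0, 0, 0) ks i)]) ->
  let c := map (int_of_digits 4) ss in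
  [/\ map (digits 4 n) c = ss,
      map (kaprekar_index 4 n) c = map index_tuple ks,
      fcycle (kaprekar 4 n) c
    & kaprekar_cycle 4 n l [fset x in c]%fset].
Proof.
move=> l1 sl cyc uk kl tr c.
have Ek : map (kaprekar_index 4 n) c = map index_tuple ks.
  rewrite -map_comp; apply: (@eq_from_nth _ [tuple 0; 0; 0; 0]);
    rewrite !size_map sl ?kl // => i il.
  rewrite (nth_map [::]) ?sl // (nth_map (0, 0, 0, 0)) ?kl //=.
  by have [k [tri En _]] := tr i il; exact: transition_index tri En.
have uc : uniq c by apply: (@map_uniq _ _ (kaprekar_index 4 n)); rewrite Ek.
split=> //.
  rewrite -map_comp; apply: (@eq_from_nth _ [::]); rewrite !size_map // sl => i il.
  rewrite (nth_map [::]) ?sl //=.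
  by have [k [tri En _]] := tr i il; exact: (transition_string tri En).1.
split=> //.
- by rewrite card_fseq undup_id // size_map.
- move=> x; rewrite inE /= => /mapP[s] /(nthP [::])[i]; rewrite sl => il <- ->.
  have [k [tri En nr]] := tr i il.
  by split; [exact: (transition_string tri En).2 | exact: transition_nonrepdigit tri En nr].
- by exists c.
Qed.

Lemma transition_diff k0 k1 k2 k3 p q r t s k' :
  gaps k0 k1 k2 k3 p q r t -> 0 < p + q + r ->
  s = diff_string p q r t -> k' = diff_index p q r t ->
  transition (k0, k1, k2, k3) s k'.
Proof. by move=> gap pqr -> ->; exact: Transition. Qed.

Lemma transition_cycle2 n s1 s2 k1 k2 :
  transition k2 s1 k1 -> transition k1 s2 k2 -> digit_count k1 = n ->
  nonrep k1 -> nonrep k2 -> uniq [:: index_tuple k1; index_tuple k2] ->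
  let ss := [:: s1; s2] in let ks := [:: index_tuple k1; index_tuple k2] in
  let c := map (int_of_digits 4) ss in
  [/\ map (digits 4 n) c = ss,
      map (kaprekar_index 4 n) c = ks,
      fcycle (kaprekar 4 n) c
    & kaprekar_cycle 4 n 2 [fset x in c]%fset].
Proof.
move=> t1 t2 n1 nr1 nr2 uk ss ks.
have n2 := transition_digit_count t2; rewrite n1 in n2.
apply: (@transitions_cycle n ss [:: k1; k2] 2) => //.
  by rewrite /= (transition2 t1 n2 t2) (transition2 t2 n1 t1) !eqxx.
by case=> [|[|]] // _; [exists k2 | exists k1].
Qed.

Lemma transition_cycle3 n s1 s2 s3 k1 k2 k3 :
  transition k3 s1 k1 -> transition k1 s2 k2 -> transition k2 s3 k3 -> digit_count k1 = n ->
  nonrep k1 -> nonrep k2 -> nonrep k3 ->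
  uniq [:: index_tuple k1; index_tuple k2; index_tuple k3] ->
  let ss := [:: s1; s2; s3] in let ks := [:: index_tuple k1; index_tuple k2; index_tuple k3] in
  let c := map (int_of_digits 4) ss in
  [/\ map (digits 4 n) c = ss,
      map (kaprekar_index 4 n) c = ks,
      fcycle (kaprekar 4 n) c
    & kaprekar_cycle 4 n 3 [fset x in c]%fset].
Proof.
move=> t1 t2 t3 n1 nr1 nr2 nr3 uk ss ks.
have n2 := transition_digit_count t2; rewrite n1 in n2.
have n3 := transition_digit_count t3; rewrite n2 in n3.
apply: (@transitions_cycle n ss [:: k1; k2; k3] 3) => //.
  by rewrite /= (transition2 t1 n3 t2) (transition2 t2 n1 t3) (transition2 t3 n2 t1) !eqxx.
by case=> [|[|[|]]] // _; [exists k3 | exists k1 | exists k2].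
Qed.

Lemma listed_cycle_facts n l ss ks : listed_cycle n l ss ks ->
  let c := map (int_of_digits 4) ss in
  [/\ map (digits 4 n) c = ss,
      map (kaprekar_index 4 n) c = ks,
      fcycle (kaprekar 4 n) c
    & kaprekar_cycle 4 n l [fset x in c]%fset].
Proof.
case=> {n l ss ks} [t t0||||].
- apply: (@transition_cycle3 _ _ _ _ (1, t + 2, t + 2, t + 3)
    (0, t + 4, t + 1, t + 3) (1, t + 2, t + 5, t)).
  + apply: (@transition_diff _ _ _ _ 1 (t - 1) 3 (t + 2));
      first by rewrite /gaps; split_minn_maxn; lia.
    * by lia.
    (* The last 1 of the block 1^t is split off, because [bottom] writes it separately, after an
       empty block of zeros. *)
    * by rewrite -{3}(subnK t0) (nseqD (t - 1) 1 1) /diff_string /top /bottom /= -!catA.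
    * by rewrite /diff_index /=; repeat congr pair; lia.
  + apply: (@transition_diff _ _ _ _ 1 (t + 2) 0 (t + 2));
      first by rewrite /gaps; split_minn_maxn; lia.
    * by lia.
    * by rewrite (_ : t + 3 = t + 2 + 1) ?(nseqD (t + 2) 1 1) //;
        last lia; rewrite /diff_string /top /bottom /= addn_gt0 orbT /= -!catA -subn1
          -addnBA.
    * by rewrite /diff_index /= addn_gt0 orbT; repeat congr pair; lia.
  + apply: (@transition_diff _ _ _ _ 0 (t + 3) 1 t);
      first by rewrite /gaps; split_minn_maxn; lia.
    * by lia.
    * by rewrite /diff_string /top /bottom /= addn_gt0 orbT /= -subn1 -?catA /=
        (_ : t + 3 - 1 = t + 2) //; lia.
    * by rewrite /diff_index /= addn_gt0 orbT; repeat congr pair; lia.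
  + by rewrite /=; lia.
  + by rewrite /=; split_minn_maxn; lia.
  + by rewrite /=; split_minn_maxn; lia.
  + by rewrite /=; split_minn_maxn; lia.
  + rewrite /= !inE -!val_eqE /= !eqseq_cons; lia.
- apply: (@transition_cycle2 _ _ _ (1, 0, 0, 1) (0, 1, 1, 0)) => //.
    by apply: (@transition_diff _ _ _ _ 0 0 1 0).
  by apply: (@transition_diff _ _ _ _ 1 0 0 0).
- apply: (@transition_cycle2 _ _ _ (1, 0, 3, 0) (0, 1, 1, 2)) => //.
    by apply: (@transition_diff _ _ _ _ 0 1 1 0).
  by apply: (@transition_diff _ _ _ _ 0 1 0 2).
- apply: (@transition_cycle2 _ _ _ (1, 0, 3, 1) (0, 1, 1, 3)) => //.
    by apply: (@transition_diff _ _ _ _ 0 1 1 1).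
  by apply: (@transition_diff _ _ _ _ 1 0 0 3).
- apply: (@transition_cycle3 _ _ _ _ (1, 1, 4, 2) (0, 3, 0, 5) (0, 3, 3, 2)) => //.
  + by apply: (@transition_diff _ _ _ _ 0 2 1 2).
  + by apply: (@transition_diff _ _ _ _ 1 1 0 4).
  + by apply: (@transition_diff _ _ _ _ 0 3 0 2).
Qed.

(** * Completeness of the list *)

Lemma settled_listed n k0 k1 k2 k3 : settled k0 k1 k2 k3 -> k0 + k1 + k2 + k3 = n ->
  (exists s, listed_fixed n s [tuple k0; k1; k2; k3]) \/
  (exists l ss ks, listed_cycle n l ss ks /\
     head [tuple 0; 0; 0; 0] ks = [tuple k0; k1; k2; k3]).
Proof.
case=> [[<- [k0_gt0 [k03 k301]]]|[[-> [<- [<- k1_gt0]]]|[[-> [<- [k1_ge3 ->]]]|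
  [[-> [-> [-> ->]]]|[[-> [-> [-> k31]]]|[-> [-> [-> ->]]]]]]]] <-.
- left; have [k3E|] := eqVneq k0 k3.
    by eexists; rewrite -k3E (_ : _ + k0 = 2 * (k0 + k1)); [apply: Symmetric | ]; lia.
  by move=> k03'; eexists; rewrite (_ : _ + k3 = k0 + 2 * k1 + k3); [apply: AlmostSymmetric |];
    lia.
- by left; eexists; rewrite (_ : _ + k1 = 3 * k1); [apply: Triad | ]; lia.
- right; exists 3; do 2 eexists; rewrite (_ : _ + _ = 3 * (k1 - 2) + 8); last lia.
  split; first by apply: SingleParameter; lia.
  have -> : k1 - 2 + 3 = k1 + 1 by lia.
  by have -> : k1 - 2 + 2 = k1 by lia.
- by right; exists 2; do 2 eexists; split; [exact: Sporadic2 |].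
- case: k3 k31 => [|[|]] // _; right; exists 2; do 2 eexists.
    by split; [exact: Sporadic4 |].
  by split; [exact: Sporadic5 |].
- by right; exists 3; do 2 eexists; split; [exact: Sporadic8 |].
Qed.

Lemma settles_iter n x k : settles k -> counts (digits 4 n x) = k ->
  exists j, let: (k0, k1, k2, k3) := counts (digits 4 n (iter j (kaprekar 4 n) x)) in
    settled k0 k1 k2 k3.
Proof.
move=> sk; elim: sk x => {k} [k0 k1 k2 k3 sk|k0 k1 k2 k3 p q r s gap pqr _ IH] x Ex.
  by exists 0; rewrite [iter _ _ _]/iter Ex.
have [|j Hj] := IH (kaprekar 4 n x).
  rewrite (kaprekar_diff_string Ex gap pqr) -(size_counts Ex).
  by rewrite (diff_stringK gap pqr).1 counts_diff_string.
by exists j.+1; rewrite iterSr.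
Qed.

Lemma fcycle_iter (f : nat -> nat) c x j : fcycle f c -> x \in c -> iter j f x \in c.
Proof.
move=> cyc xc; elim: j => //= j; move: (iter j f x) => y yc.
by rewrite (eqP (next_cycle cyc yc)) mem_next.
Qed.

(** Rotated to start at z, c is a segment of the trajectory of z, and d is closed under f. *)
Lemma fcycle_sub (f : nat -> nat) c d z : fcycle f c -> fcycle f d ->
  z \in c -> z \in d -> {subset c <= d}.
Proof.
move=> cyc cyd zc zd y yc.
have [i s Ec] := rot_to zc.
have : fcycle f (rot i c) by rewrite rot_cycle.
rewrite Ec /= rcons_path => /andP[/fpathP[m Es] _].
have : y \in z :: s by rewrite -Ec mem_rot.
rewrite Es -[z :: _]/(traject f z m.+1) => /trajectP[j _ ->].
exact: fcycle_iter.
Qed.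

(** Some y in c has a settled index, but need not be listed, as integers may share an index. Since T
    depends only on the index, T y is the image of a listed integer, hence listed, and it still lies
    in c. *)
Lemma cycle_meets_listed n c : c != [::] -> fcycle (kaprekar 4 n) c ->
  (forall x, x \in c -> x < 4 ^ n /\ ~~ repdigit 4 n x) ->
  (exists s k, listed_fixed n s k /\ int_of_digits 4 s \in c) \/
  (exists l ss ks, listed_cycle n l ss ks /\
     exists2 z, z \in c & z \in map (int_of_digits 4) ss).
Proof.
case: c => // x c _ cyc nonrep_c.
have xc : x \in x :: c by rewrite mem_head.
case Ek : (counts (digits 4 n x)) => [[[k0 k1] k2] k3].
have nonconst : maxn (maxn k0 k1) (maxn k2 k3) < k0 + k1 + k2 + k3.
  by rewrite (size_counts Ek) ltnNge -(repdigit_counts Ek); case: (nonrep_c x xc).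
have [j] := settles_iter (settles_all nonconst) Ek.
have := fcycle_iter j cyc xc; move: (iter j _ _) => y yc.
case Ey : (counts (digits 4 n y)) => [[[l0 l1] l2] l3] /settled_listed /(_ (size_counts Ey)).
have Iy := kaprekar_indexE Ey; rewrite -Iy.
have Tyc : kaprekar 4 n y \in x :: c by exact: (fcycle_iter 1 cyc yc).
case=> [[s ls]|[l [ss [ks [lc hk]]]]].
  left; exists s, (kaprekar_index 4 n y); split=> //.
  have [k' [tr En _ Ek']] := listed_fixed_transition ls.
  by rewrite -(transition2 tr En tr) (kaprekar_eq_index (y := y)) //
    (transition_index tr En) Ek'.
right; exists l, ss, ks; split=> //; exists (kaprekar 4 n y) => //.
have [_ Eks cycs _] := listed_cycle_facts lc.
case: ss lc Eks cycs => [|s ss] lc Eks cycs; first by inversion lc.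
rewrite (kaprekar_eq_index (y := int_of_digits 4 s)); last by rewrite -hk -Eks.
by apply: (fcycle_iter 1 cycs); rewrite /= mem_head.
Qed.

Theorem theorem18 (n : nat) :
  [/\ (forall (s : seq nat) (k : 4.-tuple nat),
         listed_fixed n s k ->
         let x := int_of_digits 4 s in
         [/\ digits 4 n x = s,
             kaprekar_index 4 n x = k
           & fixed_point 4 n x]),
      (forall x : nat,
         fixed_point 4 n x ->
         exists (s : seq nat) (k : 4.-tuple nat),
           listed_fixed n s k /\ x = int_of_digits 4 s),
      (forall (l : nat) (ss : seq (seq nat)) (ks : seq (4.-tuple nat)),
         listed_cycle n l ss ks ->
         let c := map (int_of_digits 4) ss in
         [/\ map (digits 4 n) c = ss,
             map (kaprekar_index 4 n) c = ks,
             fcycle (kaprekar 4 n) c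
           & kaprekar_cycle 4 n l [fset x in c]%fset])
    & (forall (l : nat) (C : {fset nat}),
         kaprekar_cycle 4 n l C ->
         exists (ss : seq (seq nat)) (ks : seq (4.-tuple nat)),
           listed_cycle n l ss ks
             /\ C = [fset x in map (int_of_digits 4) ss]%fset)].
Proof.
have fixed s k : listed_fixed n s k ->
    let x := int_of_digits 4 s in
    [/\ digits 4 n x = s, kaprekar_index 4 n x = k & fixed_point 4 n x].
  move=> /listed_fixed_transition[k' [tr En nr ->]].
  have [Ed lt_n] := transition_string tr En.
  split=> //; first exact: (transition_index tr En).
  split=> //; first exact: (transition_nonrepdigit tr En nr).
  exact: (transition2 tr En tr).
split=> //.
- move=> x [lt_n nr Tx].
  (* A fixed point is treated as a cycle with one member. *)
  have cyc : fcycle (kaprekar 4 n) [:: x] by rewrite /= Tx eqxx.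
  have [||[s [k [ls]]]|[l [ss [ks [lc [z zx zs]]]]]] := cycle_meets_listed _ cyc.
  + by [].
  + by move=> y; rewrite inE => /eqP->.
  + by rewrite inE => /eqP Ex; exists s, k.
  (* A listed cycle through x would consist of x alone, yet it has at least two members. *)
  have [_ _ cycs [l2 El _ _]] := listed_cycle_facts lc.
  have := fcycle_sub cycs cyc zs zx; move: El l2; rewrite card_fseq => <-.
  move=> l2 sub; have := uniq_leq_size (undup_uniq _) (s2 := [:: x]).
  move=> /(_ (map (int_of_digits 4) ss)); rewrite leqNgt l2 => abs.
  by have // : false; apply: abs => y; rewrite mem_undup; apply: sub.
- exact: listed_cycle_facts.
- move=> l C [l2 El nrC [c [uc cyc EC]]].
  have memC x : (x \in C) = (x \in c) by rewrite EC inE.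
  have sc : size c = l by rewrite -El EC card_fseq undup_id.
  have [|x xc|[s [k [ls zc]]]|[l' [ss [ks [lc [z zc zs]]]]]] := cycle_meets_listed _ cyc.
  + by case: (c) sc l2 => // <-.
  + by apply: nrC; rewrite memC.
  (* A listed fixed point in C would make C a singleton, contradicting 2 <= l. *)
  + have [_ _ [_ _ Tz]] := fixed s k ls.
    have cyz : fcycle (kaprekar 4 n) [:: int_of_digits 4 s] by rewrite /= Tz eqxx.
    have := uniq_leq_size uc (fcycle_sub cyc cyz zc (mem_head _ _)).
    by rewrite sc leqNgt l2.
  (* Two cycles with a common member coincide as sets, so their lengths agree too. *)
  have [_ _ cycs [_ El' _ _]] := listed_cycle_facts lc.
  have EC' : C = [fset x in map (int_of_digits 4) ss]%fset.
    apply/fsetP => x; rewrite memC inE /=.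
    by apply/idP/idP; [exact: (fcycle_sub cyc cycs zc zs) |
      exact: (fcycle_sub cycs cyc zs zc)].
  by exists ss, ks; split=> //; rewrite -El EC' El'.
Qed.
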